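(* Let $\mathcal{H}$ be a Hilbert space, let $\mathcal{A}\subset\mathcal{H}$ be a compact set, and let $f:\mathcal{H}\to\mathbb{R}$ be both $L$-smooth and $\mu$-strongly convex over $\mathrm{conv}(\mathcal{A})$. Let $q^\star$ be the minimizer of $f$ over $\mathrm{conv}(\mathcal{A})$, and let $q^t$ be the iterates of Variant 0 of the Norm-Corrective Frank-Wolfe algorithm with an approximate linear minimization oracle of relative accuracy $\delta\in(0,1]$. Then the suboptimality $\varepsilon_t:=f(q^t)-f(q^\star)$ decreases geometrically at each good step $t$: $$\varepsilon_{t+1}\le(1-\beta)\,\varepsilon_t,\qquad \beta:=\delta^2\,\frac{\mu\,\mathrm{PWidth}(\mathcal{A})^2}{L\,\mathrm{diam}(\mathcal{A})^2}\in(0,1].$$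
   Context: $\mathrm{conv}$ denotes convex hull and $\mathrm{diam}(\mathcal{A})=\max_{z_1,z_2\in\mathcal{A}}\|z_1-z_2\|$. Norm-Corrective Frank-Wolfe algorithm, Variant 0: start from $q^0\in\mathrm{conv}(\mathcal{A})$ and $\mathcal{S}:=\{q^0\}$. For $t=0,1,\dots$: the approximate oracle returns $z_t\in\mathcal{A}$ with $\langle\nabla f(q^t),z_t-q^t\rangle\le\delta\min_{s\in\mathcal{A}}\langle\nabla f(q^t),s-q^t\rangle$; set $\mathcal{S}:=\mathcal{S}\cup\{z_t\}$; let $b:=q^t-\frac1L\nabla f(q^t)$; set $q^{t+1}:=\arg\min_{z\in\mathrm{conv}(\mathcal{S})}\|z-b\|^2$. Good steps: let $\mathcal{S}_t$ be the set of active atoms (those with nonzero weight in the convex combination representing $q^t$) and let $v_t\in\arg\min_{v\in\mathcal{S}_t}\langle-\nabla f(q^t),v\rangle$ be the away vertex. Step $t$ is a bad step if it removes all the weight from $v_t$ but $|\mathcal{S}_t|=|\mathcal{S}_{t+1}|$; otherwise it is a good step. Pyramidal width: $$\mathrm{PWidth}(\mathcal{A}):=\min_{\substack{\mathcal{K}\in\mathrm{faces}(\mathrm{conv}(\mathcal{A}))\\ q\in\mathcal{K}\\ r\in\mathrm{cone}(\mathcal{K}-q)\setminus\{0\}}}\mathrm{PdirW}(\mathcal{K}\cap\mathcal{A},r,q),$$ where $\mathrm{PdirW}(\mathcal{B},r,q):=\min_{S\in\mathcal{S}_q}\max_{s\in\mathcal{B},\,v\in S}\left\langle\frac{r}{\|r\|},s-v\right\rangle$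 is the pyramidal directional width and $\mathcal{S}_q$ is the collection of subsets $S\subseteq\mathcal{B}$ such that $q$ is a convex combination of all elements of $S$ with strictly positive weights.
   Formalization: The decrease is stated at good steps where the convex combination representing q^t uses only atoms of A (it can fail while a start q^0 outside A keeps weight); β>0 is claimed only when the minimum defining PWidth(A), read as an infimum, is attained (for a disk it is not). *)

(* Defs.v *)
(* MathComp-Analysis, over an arbitrary R : realType. *)
From HB Require Import structures.
From mathcomp Require Import all_boot all_order all_algebra.
From mathcomp Require Import all_classical all_reals all_analysis.

Set Implicit Arguments.
Unset Strict Implicit.
Unset Printing Implicit Defensive.

Import Order.TTheory GRing.Theory Num.Theory.
Import numFieldNormedType.Exports.

Local Open Scope classical_set_scope.
Local Open Scope ring_scope.

Definition argmin_on (R : realType) (T : Type) (C : set T) (F : T -> R) : set T :=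
  [set x | C x /\ forall y, C y -> F x <= F y].

Section Hulls.
Context (R : realType) (H : lmodType R).
Implicit Types (S K C : set H) (c : H -> R) (x r : H).

Definition active c : set H := [set a | c a != 0].

(* x is the conic combination, with weights c, of finitely many points of S. *)
Definition conic_comb S c x : Prop :=
  [/\ finite_set (active c), active c `<=` S, forall a, 0 <= c a
    & x = \sum_(a \in active c) c a *: a].

Definition convex_comb S c x : Prop :=
  conic_comb S c x /\ \sum_(a \in active c) c a = 1.

Definition conv_hull S : set H := [set x | exists c, convex_comb S c x].

Definition conic_hull S : set H := [set x | exists c, conic_comb S c x].

(* Faces in the sense of extreme subsets; for a polytope these are the usual
   faces, the polytope itself included. *)
Definition is_face C K : Prop :=
  [/\ convex_set (K : set (convex_lmodType H)), K `<=` C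
    & forall x y (t : R), C x -> C y -> 0 < t < 1 ->
        K ((1 - t) *: x + t *: y) -> K x /\ K y].

End Hulls.

(* A real Hilbert space is a complete normed space H together with a scalar
   product dot that induces its norm. *)
Section Geometry.
Context (R : realType) (H : completeNormedModType R) (dot : {dot H for @idfun R}).
Implicit Types (A B S K : set H) (q r : H) (f : H -> R) (g : H -> H).

Definition induces_norm : Prop := forall x : H, `|x| ^+ 2 = dot x x.

Definition diam A : R := sup [set `|z.1 - z.2| | z in A `*` A].

(* The collection S_q: the supports of the convex combinations of points of B
   representing q. *)
Definition supports B q : set (set H) :=
  [set S | exists2 c, convex_comb B c q & S = active c].

Definition PdirW B r q : R :=
  inf [set sup [set dot (`|r|^-1 *: r) (p.1 - p.2) | p in B `*` S]
      | S in supports B q].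

(* The admissible triples (K, q, r) in the definition of the pyramidal width. *)
Definition pyramidal_triple A (p : set H * H * H) : Prop :=
  let: (K, q, r) := p in
  [/\ is_face (conv_hull A) K, K q, conic_hull [set k - q | k in K] r & r != 0].

Definition PdirW_triple A (p : set H * H * H) : R :=
  let: (K, q, r) := p in PdirW (K `&` A) r q.

(* The infimum of the pyramidal directional widths. For a general compact A it
   need not be attained: it is 0, hence not attained, for a disk. *)
Definition PWidth A : R := inf [set PdirW_triple A p | p in pyramidal_triple A].

Definition PWidth_attained A : Prop :=
  exists2 p, pyramidal_triple A p & PdirW_triple A p = PWidth A.

(* For a Frechet differentiable f, this characterizes g as its gradient. *)
Definition gradient_on (Q : set H) f g : Prop :=
  forall x, Q x -> is_diff x (f : H -> R^o) (dot (g x) : H -> R^o).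

Definition smooth_on (Q : set H) f g (L : R) : Prop :=
  forall x y, Q x -> Q y ->
    f y <= f x + dot (g x) (y - x) + L / 2 * `|y - x| ^+ 2.

Definition strongly_convex_on (Q : set H) f g (mu : R) : Prop :=
  forall x y, Q x -> Q y ->
    f x + dot (g x) (y - x) + mu / 2 * `|y - x| ^+ 2 <= f y.

Definition approx_LMO A (delta : R) (d q z : H) : Prop :=
  A z /\ dot d (z - q) <= delta * inf [set dot d (s - q) | s in A].

(* The set S at the beginning of iteration t: the starting point and the
   oracle answers z_0, ..., z_{t-1}. *)
Definition corrective_set (q0 : H) (z : nat -> H) (t : nat) : set H :=
  q0 |` [set z i | i in `I_t].

(* q and z are the iterates and the oracle answers of a run of Variant 0 of
   norm-corrective Frank-Wolfe, for an objective with gradient g. *)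
Definition NCFW_run A g (L delta : R) (q z : nat -> H) : Prop :=
  conv_hull A (q 0%N) /\
  forall t, approx_LMO A delta (g (q t)) (q t) (z t) /\
    argmin_on (conv_hull (corrective_set (q 0%N) z t.+1))
      (fun y => `|y - (q t - L^-1 *: g (q t))| ^+ 2) (q t.+1).

(* A convex combination representing an iterate need not be unique; c t
   records the one the run maintains for q t. Its points are atoms, that is,
   elements of A, except possibly for the starting point q 0, which is only
   required to lie in the convex hull of A. *)
Definition NCFW_weights (q z : nat -> H) (c : nat -> H -> R) : Prop :=
  forall t, convex_comb (corrective_set (q 0%N) z t) (c t) (q t).

Definition away_vertex (d : H) (c : H -> R) (v : H) : Prop :=
  argmin_on (active c) (fun a => dot (- d) a) v.

(* The step from weights c to weights c' with away vertex v; the sets of active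
   atoms are finite, so [#=] says that they have as many elements. *)
Definition bad_step (v : H) (c c' : H -> R) : Prop :=
  c' v = 0 /\ (active c #= active c')%card.

Definition good_step (v : H) (c c' : H -> R) : Prop := ~ bad_step v c c'.

End Geometry.

(* Main.v *)
(** Smoothness and the choice of q^{t+1} bound f(q^{t+1}) by the quadratic upper
    model of f at q^t, evaluated at any y in conv(S). Write q^t = sum w_a a, and
    let b be the weights of q* that are closest to w in l^1, tau being the mass
    that has to be moved. Then tau * PWidth(A) <= |q* - q^t|, so that strong
    convexity controls tau. Take for y the point obtained by moving to the oracle
    answer z a fraction theta of either the mass which the transport to b
    removes, or a proportional share tau of all the weights, whichever has the
    better slope: thus |y - q^t| <= theta * tau * diam(A), while the slope of f
    along y - q^t is at most theta * delta times the slope along q* - q^t. The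
    choice theta = delta * mu * PWidth(A)^2 / (L * diam(A)^2) gives the claim.

    For the inequality tau * PWidth(A) <= |q* - q^t|, let p and p' be the points
    that carry the removed and the added mass. By minimality of tau, no
    representation of p' uses an atom of p. Among all such pairs choose one at
    minimal distance and put r = p' - p: then every atom of p is at the same
    level for r, and no atom of A is higher than p', so that |r| is the pyramidal
    directional width in direction r at p. This argument needs finitely many
    atoms; if PWidth(A) > 0 then conv(A) is the hull of any sufficiently fine
    finite net of A. *)

Require Import Defs.
From HB Require Import structures.
From mathcomp Require Import all_boot all_order all_algebra.
From mathcomp Require Import all_classical all_reals all_analysis.
From mathcomp Require Import ring lra.

Set Implicit Arguments.
Unset Strict Implicit.
Unset Printing Implicit Defensive.

Import Order.TTheory GRing.Theory Num.Theory.
Import numFieldNormedType.Exports.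

Local Open Scope classical_set_scope.
Local Open Scope ring_scope.

(** * Scalar product and norm *)

Section Dot.
Context (R : realType) (H : completeNormedModType R)
  (dot : {dot H for @idfun R}) (dot_norm : induces_norm dot).
Implicit Types (x y u v : H) (k : R).

Lemma dotC x y : dot x y = dot y x.
Proof. by rewrite (@hermitian_subproof _ _ _ _ dot) expr0 mul1r. Qed.

Lemma dotDr x y u : dot x (y + u) = dot x y + dot x u.
Proof. exact: raddfD. Qed.

Lemma dotNr x y : dot x (- y) = - dot x y.
Proof. exact: raddfN. Qed.

Lemma dotBr x y u : dot x (y - u) = dot x y - dot x u.
Proof. exact: raddfB. Qed.

Lemma dotZr x k y : dot x (k *: y) = k * dot x y.
Proof. exact: linearZ. Qed.

Lemma dot0r x : dot x 0 = 0.
Proof. exact: raddf0. Qed.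

Lemma dot_sumr x (I : finType) (F : I -> H) :
  dot x (\sum_i F i) = \sum_i dot x (F i).
Proof. exact: raddf_sum. Qed.

Lemma dotDl x y u : dot (x + y) u = dot x u + dot y u.
Proof. by rewrite dotC dotDr !(dotC u). Qed.

Lemma dotNl x y : dot (- x) y = - dot x y.
Proof. by rewrite dotC dotNr dotC. Qed.

Lemma dotZl x k y : dot (k *: x) y = k * dot x y.
Proof. by rewrite dotC dotZr dotC. Qed.

Lemma sqr_normD x y : `|x + y| ^+ 2 = `|x| ^+ 2 + 2 * dot x y + `|y| ^+ 2.
Proof. rewrite !dot_norm dotDl !dotDr (dotC y x); ring. Qed.

Lemma sqr_normB x y : `|x - y| ^+ 2 = `|x| ^+ 2 - 2 * dot x y + `|y| ^+ 2.
Proof. by rewrite sqr_normD dotNr normrN; ring. Qed.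

Lemma dot_le_norm x y : dot x y <= `|x| * `|y|.
Proof.
have [->|y0] := eqVneq y 0; first by rewrite dot0r normr0 mulr0.
have [->|x0] := eqVneq x 0; first by rewrite dotC dot0r normr0 mul0r.
have nx : 0 < `|x| by rewrite normr_gt0.
have ny : 0 < `|y| by rewrite normr_gt0.
have := sqr_ge0 (`| `|y| *: x - `|x| *: y |).
rewrite sqr_normB !normrZ !normr_id dotZl dotZr.
have -> : (`|y| * `|x|) ^+ 2 - 2 * (`|y| * (`|x| * dot x y)) + (`|x| * `|y|) ^+ 2
  = (2 * (`|x| * `|y|)) * (`|x| * `|y| - dot x y) by ring.
by rewrite pmulr_rge0 ?subr_ge0// !mulr_gt0.
Qed.

(* Compare |r - e u|^2 with |r|^2 for small e. *)
Lemma dot_le0_of_min (r u : H) (e0 : R) : 0 < e0 ->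
  (forall e : R, 0 < e <= e0 -> `|r| <= `|r - e *: u|) -> dot r u <= 0.
Proof.
move=> e00 min; rewrite leNgt; apply/negP => ru.
have u0 : 0 < dot u u.
  rewrite -dot_norm exprn_gt0 ?normr_gt0//.
  by apply: contraTneq ru => ->; rewrite dot0r ltxx.
pose e := Num.min e0 (dot r u / dot u u).
have e_gt0 : 0 < e by rewrite lt_min e00 divr_gt0.
have : `|r| ^+ 2 <= `|r - e *: u| ^+ 2.
  by rewrite ler_pXn2r ?nnegrE// min// e_gt0 ge_min lexx.
rewrite sqr_normB dotZr normrZ exprMn (dot_norm u) (ger0_norm (ltW e_gt0)).
have : e * dot u u <= dot r u by rewrite -ler_pdivlMr// ge_min lexx orbT.
move=> /(ler_wpM2l (ltW e_gt0)) h1 h2.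
have h3 : 0 < e * dot r u by rewrite mulr_gt0.
nra.
Qed.

End Dot.

(** * Finite families of atoms *)

Section Comb.
Context (R : realType) (H : normedModType R) (n : nat) (a : 'I_n -> H).
Implicit Types (w : 'rV[R]_n) (i j : 'I_n).

Definition comb w : H := \sum_i w 0 i *: a i.

Lemma combD w1 w2 : comb (w1 + w2) = comb w1 + comb w2.
Proof. by rewrite -big_split/=; apply: eq_bigr => i _; rewrite mxE scalerDl. Qed.

Lemma combZ k w : comb (k *: w) = k *: comb w.
Proof. by rewrite scaler_sumr; apply: eq_bigr => i _; rewrite mxE scalerA. Qed.

Lemma combN w : comb (- w) = - comb w.
Proof. by rewrite -scaleN1r combZ scaleN1r. Qed.

Lemma combB w1 w2 : comb (w1 - w2) = comb w1 - comb w2.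
Proof. by rewrite combD combN. Qed.

Lemma comb_delta i : comb (delta_mx 0 i) = a i.
Proof.
rewrite /comb (bigD1 i)//= big1 ?addr0 => [|j ji]; rewrite mxE eqxx ?scale1r//.
  by rewrite eqxx scale1r.
by rewrite (negPf ji) scale0r.
Qed.

Lemma comb_toward e w i :
  comb ((1 - e) *: w + e *: delta_mx 0 i) = comb w + e *: (a i - comb w).
Proof.
by rewrite combD !combZ comb_delta scalerBl scale1r scalerBr addrAC addrA.
Qed.

Lemma continuous_comb : continuous comb.
Proof.
apply: continuous_big => [|i _ w]; first exact: add_continuous.
exact: (@cvgZr_tmp _ _ _ (nbhs w) _ _ _ (a i) (@coord_continuous R 1 n 0 i w)).
Qed.

End Comb.

Section Simplex.
Context (R : realType) (n : nat).
Implicit Types (w : 'rV[R]_n) (i j : 'I_n).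

Definition simplex : set 'rV[R]_n :=
  [set w | (forall i, 0 <= w 0 i) /\ \sum_i w 0 i = 1].

Lemma simplex_delta i : simplex (delta_mx 0 i).
Proof.
split=> [j|]; first by rewrite mxE ler0n.
rewrite (bigD1 i)//= big1 ?addr0 => [|j ji]; rewrite mxE eqxx ?eqxx//.
by rewrite (negPf ji).
Qed.

Lemma simplex_conv (k : R) w1 w2 : 0 <= k <= 1 -> simplex w1 -> simplex w2 ->
  simplex ((1 - k) *: w1 + k *: w2).
Proof.
move=> /andP[k0 k1] [w10 w11] [w20 w21]; split=> [i|].
  by rewrite !mxE addr_ge0 ?mulr_ge0 ?subr_ge0.
under eq_bigr do rewrite !mxE.
by rewrite big_split -!mulr_sumr /= w11 w21 !mulr1 subrK.
Qed.

Lemma simplex_le1 w i : simplex w -> w 0 i <= 1.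
Proof.
by move=> [w0 <-]; rewrite (bigD1 i)//= lerDl sumr_ge0.
Qed.

Lemma closed_simplex : closed simplex.
Proof.
rewrite [X in closed X](_ : _ = (\bigcap_(i in [set: 'I_n]) [set w : 'rV[R]_n | 0 <= w 0 i])
   `&` [set w | \sum_i w 0 i = 1]); last first.
  apply/seteqP; split=> w [w0 w1]; split=> // i; [move=> _; exact: w0|exact: (w0 i I)].
apply: closedI.
  apply: closed_bigI => i _.
  apply: (@preimage_closed _ _ (fun w : 'rV[R]_n => w 0 i) [set x | 0 <= x]) => //.
  by move=> *; exact: coord_continuous.
apply: (@preimage_closed _ _ (fun w : 'rV[R]_n => \sum_i w 0 i) [set 1]) => //.
move=> w _; apply: continuous_big => [|i _]; first exact: add_continuous.
exact: coord_continuous.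
Qed.

Lemma compact_simplex : compact simplex.
Proof.
have cB : compact [set w : 'rV[R]_n | forall i, `[0%R, 1%R]%classic (w ord0 i)].
  by apply: (@rV_compact R n (fun=> `[0%R, 1%R]%classic)) => i; exact: segment_compact.
apply: (subclosed_compact closed_simplex cB).
by move=> w wS i /=; rewrite in_itv/= wS.1 simplex_le1.
Qed.

End Simplex.

(** * Pairs of weights with blocked supports *)

Section Blocked.
Context (R : realType) (H : completeNormedModType R)
  (dot : {dot H for @idfun R}) (dot_norm : induces_norm dot).
Context (n : nat) (a : 'I_n -> H).
Implicit Types (b c : 'rV[R]_n) (i j : 'I_n).

(** With [c] the removed and [c'] the added weights of a transport, this records what minimality of
    the moved mass gives: an atom of [c] reused in a representation of the point of [c'] would leave
    less mass to move. *)
Definition blocked c' c := forall b, simplex b -> comb a b = comb a c' ->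
  forall i, c 0 i != 0 -> b 0 i = 0.

(** Only closedness needs an argument. Suppose that some [b] representing the point of the limit
    [c'] uses an atom of the limit [c]. Adding half of [b - c'] to a nearby [x'] then represents the
    point of [x'] with that same atom, against the blocking of the nearby pair. *)
Lemma compact_blocked :
  compact [set x : 'rV[R]_n * 'rV[R]_n |
    [/\ simplex x.1, simplex x.2 & blocked x.1 x.2]].
Proof.
pose S := @simplex R n.
have cS : compact (S `*` S) by apply: compact_setX; exact: compact_simplex.
apply: (subclosed_compact _ cS); last by move=> x [].
move=> [c' c] cl.
have cl1 : S c'.
  apply: closed_simplex => B Bc'.
  have /cl[[x y] [[/= xS _ _] xB]] : nbhs (c', c) (fst @^-1` B).
    exact: cvg_fst Bc'.
  by exists x.
have cl2 : S c.
  apply: closed_simplex => B Bc.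
  have /cl[[x y] [[/= _ yS _] yB]] : nbhs (c', c) (snd @^-1` B).
    exact: cvg_snd Bc.
  by exists y.
split=> // b bS bc' i ci; apply/eqP; apply: contraT => bi /=.
have ci0 : 0 < c 0 i by rewrite lt_neqAle eq_sym ci cl2.1.
have n1 : nbhs (c', c) [set x : 'rV[R]_n * 'rV[R]_n | 0 < x.2 0 i].
  have h : nbhs c [set w : 'rV[R]_n | 0 < w 0 i].
    by apply: (@coord_continuous R 1 n 0 i c [set x | 0 < x]); exact: lt_nbhsr.
  exact: (cvg_snd h).
(* Near [c'], positive coordinates stay above half their value; this keeps the perturbed weights [d]
   nonnegative. *)
have n2 : nbhs (c', c) [set x : 'rV[R]_n * 'rV[R]_n |
    forall j, c' 0 j != 0 -> c' 0 j / 2 < x.1 0 j].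
  suff n2j j : nbhs (c', c) [set x : 'rV[R]_n * 'rV[R]_n |
      c' 0 j != 0 -> c' 0 j / 2 < x.1 0 j].
    by have := @filter_forall _ _ _ (nbhs ((c', c) : 'rV[R]_n * 'rV[R]_n)) _ n2j; apply.
  have [->|] := eqVneq (c' 0 j) 0.
    by apply: (@filterE _ (nbhs (c', c))) => x.
  move=> cj; have h : nbhs c' [set w : 'rV[R]_n | c' 0 j / 2 < w 0 j].
    apply: (@coord_continuous R 1 n 0 j c' [set x | c' 0 j / 2 < x]); apply: lt_nbhsr.
    rewrite ltr_pdivrMr// ltr_pMr ?ltr1n//.
    by rewrite lt_neqAle eq_sym cj cl1.1.
  have h' : nbhs (c', c) [set x : 'rV[R]_n * 'rV[R]_n | c' 0 j / 2 < x.1 0 j].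
    exact: (cvg_fst h).
  exact: (@filterS _ (nbhs ((c', c) : 'rV[R]_n * 'rV[R]_n)) _ _ _ (fun x hx _ => hx) h').
have n12 := @filterI _ (nbhs ((c', c) : 'rV[R]_n * 'rV[R]_n)) _ _ _ n1 n2.
have [[x' x] [[/= x'S xS bl] [/= xi x'j]]] := cl _ (n12 (nbhs_filter _)).
pose d := x' + 2^-1 *: (b - c').
have dE j : d 0 j = x' 0 j + 2^-1 * (b 0 j - c' 0 j) by rewrite !mxE.
have dge j : 2^-1 * b 0 j <= d 0 j.
  rewrite dE; have [cj|/x'j] := eqVneq (c' 0 j) 0; last by lra.
  by rewrite cj subr0 lerDr x'S.1.
have dS : simplex d.
  split=> [j|]; first by apply: le_trans (dge j); rewrite mulr_ge0 ?bS.1.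
  under eq_bigr do rewrite dE.
  by rewrite big_split/= -mulr_sumr sumrB x'S.2 bS.2 cl1.2 subrr mulr0 addr0.
have dx : comb a d = comb a x' by rewrite combD combZ combB bc' subrr scaler0 addr0.
have := bl d dS dx i (lt0r_neq0 xi).
have := dge i; have : 0 < b 0 i by rewrite lt_neqAle eq_sym bi bS.1.
lra.
Qed.

Lemma wmean0_supp c (h : 'I_n -> R) : simplex c ->
  (forall j, c 0 j != 0 -> h j <= 0) -> \sum_j c 0 j * h j = 0 ->
  forall j, c 0 j != 0 -> h j = 0.
Proof.
move=> cS h0 /eqP; rewrite -oppr_eq0 -sumrN psumr_eq0 => [/allP/= hj j cj|j _].
  by have /= := hj j (mem_index_enum _); rewrite oppr_eq0 mulf_eq0 (negPf cj)/= => /eqP.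
have [->|cj] := eqVneq (c 0 j) 0; first by rewrite mul0r oppr0.
by rewrite -mulrN mulr_ge0 ?oppr_ge0 ?h0// cS.1.
Qed.

Lemma dot_comb_mean x c (p : H) : simplex c ->
  \sum_j c 0 j * dot x (a j - p) = dot x (comb a c - p).
Proof.
move=> cS; rewrite /comb dotBr dot_sumr.
under eq_bigr do rewrite dotBr mulrBr.
rewrite sumrB -mulr_suml cS.2 mul1r; congr (_ - _).
by apply: eq_bigr => j _; rewrite dotZr.
Qed.

(** [W] stands for the pyramidal width, and [W_le] for the way it enters: the directional width
    taken at the support of one representation, towards another point of the hull, bounds [W] from
    above. *)
Context (W : R) (W_le : forall c c' (kappa : R), simplex c -> simplex c' ->
  comb a c' != comb a c ->
  (forall i j, c 0 j != 0 ->
    dot (comb a c' - comb a c) (a i - a j) <= kappa * `|comb a c' - comb a c|) ->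
  W <= kappa).

(* At a pair of minimal distance, a_i can be moved away from inside the face of
   c' if a_i belongs to it, and mixed into c otherwise. *)
Lemma blocked_dist c' c : simplex c' -> simplex c -> blocked c' c ->
  W <= `|comb a c' - comb a c|.
Proof.
move=> c'S cS bl.
pose C := [set x : 'rV[R]_n * 'rV[R]_n |
    [/\ simplex x.1, simplex x.2 & blocked x.1 x.2]].
pose F (x : 'rV[R]_n * 'rV[R]_n) := `|comb a x.1 - comb a x.2|.
have cF : continuous F.
  move=> x; apply: cvg_norm; apply: cvgB.
    by apply: cvg_comp; [exact: cvg_fst|exact: continuous_comb].
  by apply: cvg_comp; [exact: cvg_snd|exact: continuous_comb].
have [||[d' d]] := @compact_EVT_min _ R F C _ compact_blocked.
- by exists (c', c).
- exact: continuous_subspaceT.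
rewrite inE => -[/= d'S dS dbl] dmin.
have {}dmin e' e : simplex e' -> simplex e -> blocked e' e ->
    `|comb a d' - comb a d| <= `|comb a e' - comb a e|.
  by move=> *; apply: (dmin (e', e)); rewrite inE.
apply: le_trans (dmin _ _ c'S cS bl).
set p' := comb a d'; set p := comb a d; pose r := p' - p.
(* If the points coincided, [d] would represent [p'], and blocking would make all its weights
   vanish. *)
have pp' : p' != p.
  apply/eqP => pp'.
  have d0 i : d 0 i = 0.
    by have [//|/(dbl d dS (esym pp') i)] := eqVneq (d 0 i) 0.
  by have := dS.2; rewrite big1 // => /esym/eqP; rewrite oner_eq0.
have out i : (forall b, simplex b -> comb a b = p' -> b 0 i = 0) ->
    dot r (a i - p) <= 0.
  move=> iout; apply: (dot_le0_of_min dot_norm ltr01) => e /andP[e0 e1].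
  have -> : r - e *: (a i - p) = comb a d' - comb a ((1 - e) *: d + e *: delta_mx 0 i).
    by rewrite comb_toward opprD addrA.
  apply: dmin => //; first by apply: simplex_conv => //; [rewrite (ltW e0)|exact: simplex_delta].
  move=> b bS bp' j; rewrite !mxE /=.
  have [->|ij] := eqVneq j i; first by move=> _; exact: iout.
  by rewrite mulr0 addr0 mulf_eq0 negb_or => /andP[_]; exact: dbl.
have out_supp j : d 0 j != 0 -> forall b, simplex b -> comb a b = p' -> b 0 j = 0.
  by move=> dj b bS bp'; exact: dbl dj.
have supp : forall j, d 0 j != 0 -> dot r (a j - p) = 0.
  apply: (wmean0_supp dS) => [j dj|]; first exact: out (out_supp _ dj).
  by rewrite dot_comb_mean// subrr dot0r.
have face i b : simplex b -> comb a b = p' -> b 0 i != 0 -> dot r (a i - p') <= 0.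
  move=> bS bp' bi.
  have bi0 : 0 < b 0 i by rewrite lt_neqAle eq_sym bi bS.1.
  apply: (dot_le0_of_min dot_norm bi0) => e /andP[e0 ebi].
  (* [f] pushes [p'] away from [a i]; the bound [e <= b 0 i] keeps its weight at [i] nonnegative. *)
  pose f := (1 + e) *: b - e *: delta_mx 0 i.
  have -> : r - e *: (a i - p') = comb a f - comb a d.
    rewrite combB !combZ comb_delta bp' -/p /r scalerBr scalerDl scale1r.
    by rewrite opprB -!addrA; congr (_ + _); rewrite addrC addrA.
  have fS : simplex f.
    split=> [j|].
      rewrite !mxE /=; have [->|ji] := eqVneq j i; last first.
        by rewrite mulr0 subr0 mulr_ge0 ?bS.1// addr_ge0// ltW.
      have : 0 <= e * b 0 i by rewrite mulr_ge0// ltW.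
      by rewrite mulr1; lra.
    under eq_bigr do rewrite !mxE.
    rewrite sumrB -!mulr_sumr bS.2 (bigD1 i)//= big1 => [|j /negPf ->]; last by rewrite ?eqxx.
    by rewrite !eqxx addr0 !mulr1 addrK.
  apply: dmin => // g gS gf j dj.
  have e1 : 0 < 1 + e by rewrite addr_gt0.
  (* Mixing a share [k] of [a i] into the point of [f] gives back [p']. A representation [g] of that
     point thus yields one of [p'], and blocking passes from [d'] to [f]. *)
  pose k := e / (1 + e).
  have k1 : 1 - k = (1 + e)^-1 by rewrite /k -{1}(mulfV (lt0r_neq0 e1)) -mulrBl addrK mul1r.
  have k01 : 0 <= k <= 1.
    by rewrite (divr_ge0 (ltW e0) (ltW e1))/= -subr_ge0 k1 invr_ge0 ltW.
  have := dbl _ (simplex_conv k01 gS (simplex_delta R i)) _ j dj.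
  rewrite combD !combZ comb_delta gf combB !combZ comb_delta bp' k1.
  rewrite scalerBr !scalerA mulVf ?lt0r_neq0// scale1r [_^-1 * e]mulrC subrK => /(_ erefl).
  rewrite !mxE => /eqP; rewrite paddr_eq0; first last.
  - by rewrite mulr_ge0// (andP k01).1.
  - by rewrite mulr_ge0 ?invr_ge0 ?(ltW e1) ?gS.1.
  by rewrite mulf_eq0 invr_eq0 gt_eqF//= => /andP[/eqP].
apply: (W_le dS d'S pp') => i j dj; rewrite -/p -/p' -/r.
have rr : dot r (p' - p) = `|r| * `|r| by rewrite -expr2 dot_norm.
have -> : dot r (a i - a j) = dot r (a i - p) - dot r (a j - p).
  by rewrite !dotBr; ring.
rewrite (supp _ dj) subr0.
(* An atom used by some representation of [p'] is no higher than [p']; any other atom is no higher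
   than [p]. *)
have [[b [bS bp' bi]]|nb] := pselect (exists b, [/\ simplex b, comb a b = p' & b 0 i != 0]).
  have := face _ _ bS bp' bi; rewrite -rr !dotBr; lra.
apply: le_trans (out i _) _; last by rewrite mulr_ge0.
move=> b bS bp'; apply/eqP; apply: contra_notT nb => bi.
by exists b.
Qed.

End Blocked.

(** * Transport of mass between weight vectors *)

Section Excess.
Context (R : realType) (n : nat).
Implicit Types (b c : 'rV[R]_n).

(** The mass arriving at [i] when [c] is transported to [b]; with the arguments swapped, the mass
    leaving [i]. *)
Definition excess b c i := Num.max (b 0 i - c 0 i) 0.

Lemma excess_ge0 b c i : 0 <= excess b c i.
Proof. by rewrite le_max lexx orbT. Qed.

Lemma excess_le b c i : simplex b -> simplex c -> excess b c i <= b 0 i.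
Proof. by move=> bS cS; rewrite ge_max gerBl bS.1 cS.1. Qed.

Lemma excessB b c i : excess b c i - excess c b i = b 0 i - c 0 i.
Proof.
rewrite /excess -(opprB (b 0 i)); have [h|/ltW h] := leP 0 (b 0 i - c 0 i).
  by rewrite max_r ?oppr_le0// subr0.
by rewrite max_l ?oppr_ge0// sub0r opprK.
Qed.

Lemma excessD b c i : excess b c i + excess c b i = `|b 0 i - c 0 i|.
Proof.
rewrite /excess -(opprB (b 0 i)); have [h|/ltW h] := leP 0 (b 0 i - c 0 i).
  by rewrite max_r ?oppr_le0// addr0 ger0_norm.
by rewrite max_l ?oppr_ge0// add0r ler0_norm.
Qed.

Lemma sum_excess b c : simplex b -> simplex c ->
  \sum_i excess b c i = (\sum_i `|b 0 i - c 0 i|) / 2.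
Proof.
move=> bS cS; under [X in _ = X / 2]eq_bigr do rewrite -excessD.
rewrite big_split/= -[X in (_ + X) / 2](addrNK (\sum_i excess b c i)) -sumrB.
under [X in (_ + (X + _)) / 2]eq_bigr do rewrite excessB.
by rewrite sumrB bS.2 cS.2 subrr add0r mulrDl -splitr.
Qed.

End Excess.

Section Exchange.
Context (R : realType) (H : completeNormedModType R)
  (dot : {dot H for @idfun R}) (dot_norm : induces_norm dot).
Context (n : nat) (a : 'I_n -> H).
Implicit Types (b c : 'rV[R]_n) (i j : 'I_n).

Lemma compact_fiber (y : H) : compact [set b | simplex b /\ comb a b = y].
Proof.
apply: (subclosed_compact _ (@compact_simplex R n)); last by move=> b [].
apply: closedI; first exact: closed_simplex.
apply: (@preimage_closed _ _ (comb a) [set y]).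
  by move=> b _; exact: continuous_comb.
by apply: compact_closed; [exact: norm_hausdorff|exact: compact_set1].
Qed.

Context (W : R) (W_le : forall c c' (kappa : R), simplex c -> simplex c' ->
  comb a c' != comb a c ->
  (forall i j, c 0 j != 0 ->
    dot (comb a c' - comb a c) (a i - a j) <= kappa * `|comb a c' - comb a c|) ->
  W <= kappa).

(* Pass from c to the weights b of comb a c0 that are closest to c in l^1: the
   removed and the added parts of the weights are then blocked. *)
Lemma exchange c c0 : simplex c -> simplex c0 ->
  exists b, [/\ simplex b, comb a b = comb a c0
    & (\sum_i `|b 0 i - c 0 i|) / 2 * W <= `|comb a c0 - comb a c|].
Proof.
move=> cS c0S; pose F b := \sum_i `|b 0 i - c 0 i|.
have cF : continuous F.
  apply: continuous_big => [|i _ b]; first exact: add_continuous.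
  apply: (@continuous_comp _ _ _ (fun b => b 0 i - c 0 i) (fun x : R => `|x|)).
    exact: (@cvgB _ _ _ (nbhs b) _ _ _ _ _ (@coord_continuous R 1 n 0 i b)
      (@cvg_cst _ _ _ (nbhs b) _)).
  exact: norm_continuous.
have [||b] := @compact_EVT_min _ R F _ _ (@compact_fiber (comb a c0)).
- by exists c0.
- exact: continuous_subspaceT.
rewrite inE => -[/= bS bc0] bmin; exists b; split=> //.
rewrite -/(F b); set tau := F b / 2; rewrite -bc0.
have tau0 : 0 <= tau by rewrite divr_ge0// sumr_ge0.
have [->|tauN0] := eqVneq tau 0; first by rewrite mul0r.
have {tauN0}tau0 : 0 < tau by rewrite lt_neqAle eq_sym tauN0.
pose P i := excess c b i; pose N i := excess b c i.
have P0 i : 0 <= P i := excess_ge0 c b i.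
have N0 i : 0 <= N i := excess_ge0 b c i.
have NBP i : N i - P i = b 0 i - c 0 i := excessB b c i.
have sN : \sum_i N i = tau := sum_excess bS cS.
have sP : \sum_i P i = tau.
  by rewrite (sum_excess cS bS); under eq_bigr do rewrite distrC.
(* The removed and the added mass, rescaled to total weight 1. *)
pose m := \row_i (tau^-1 * P i); pose m' := \row_i (tau^-1 * N i).
have mS : simplex m.
  split=> [i|]; first by rewrite mxE mulr_ge0// invr_ge0 ltW.
  by under eq_bigr do rewrite mxE; rewrite -mulr_sumr sP mulVf// gt_eqF.
have m'S : simplex m'.
  split=> [i|]; first by rewrite mxE mulr_ge0// invr_ge0 ltW.
  by under eq_bigr do rewrite mxE; rewrite -mulr_sumr sN mulVf// gt_eqF.
have m'm : m' - m = tau^-1 *: (b - c).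
  by apply/rowP => i; rewrite !mxE -mulrBr NBP.
suff bl : blocked a m' m.
  have := blocked_dist dot_norm W_le m'S mS bl.
  rewrite -!combB m'm combZ normrZ gtr0_norm ?invr_gt0//.
  by rewrite ler_pdivlMl.
move=> e eS em' i; rewrite mxE mulf_eq0 negb_or => /andP[_ Pi].
apply/eqP; apply: contraT => ei.
have {}Pi : 0 < P i by rewrite lt_neqAle eq_sym Pi P0.
have {}ei : 0 < e 0 i by rewrite lt_neqAle eq_sym ei eS.1.
(* The added part of [b] is replaced by [tau *: e]. At [i] addition and removal now partly cancel,
   so [d] is strictly closer to [c] than [b] is. *)
pose d := b + tau *: (e - m').
have dE j : d 0 j = b 0 j - N j + tau * e 0 j.
  rewrite !mxE mulrBr mulrA mulfV ?gt_eqF// mul1r; ring.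
have dc j : d 0 j - c 0 j = tau * e 0 j - P j.
  by rewrite dE; have := NBP j; lra.
have dS : simplex d.
  split=> [j|].
    rewrite dE addr_ge0//; last by apply: mulr_ge0; [exact: ltW|exact: eS.1].
    by rewrite subr_ge0; exact: excess_le.
  under eq_bigr do rewrite dE.
  by rewrite big_split/= sumrB -mulr_sumr bS.2 sN eS.2 mulr1 subrK.
have db : comb a d = comb a c0.
  by rewrite combD combZ combB em' subrr scaler0 addr0.
have := bmin d; rewrite inE => /(_ (conj dS db)); rewrite leNgt => /negP; case.
have -> : F b = \sum_j (tau * e 0 j + P j).
  by rewrite big_split/= -mulr_sumr eS.2 sP mulr1 /tau -splitr.
rewrite /F (bigD1 i)//= [ltRHS](bigD1 i)//= ltr_leD//.
  rewrite dc; have : 0 < tau * e 0 i by rewrite mulr_gt0.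
  by move=> h; rewrite ltr_norml; apply/andP; split; lra.
apply: ler_sum => j _; rewrite dc; apply: le_trans (ler_normB _ _) _.
by rewrite !ger0_norm//; apply: mulr_ge0; [exact: ltW|exact: eS.1].
Qed.

End Exchange.

(** * Convex hulls and the pyramidal width *)

Section MassComb.
Context (R : realType) (H : lmodType R).
Implicit Types (S T : set H) (c : H -> R) (x y : H) (r : seq H) (k l : R).

Lemma sum_active (V : nmodType) c r (F : H -> V) : uniq r ->
  active c `<=` [set` r] -> (forall x, c x = 0 -> F x = 0) ->
  \sum_(x \in active c) F x = \sum_(x <- r) F x.
Proof.
move=> ur cr F0; apply: fsbig_fwiden => // x [_ /negP/negbNE/eqP]; exact: F0.
Qed.

(** Conic combinations of total weight [k], summed over an explicit list. Points and weights add and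
    scale together, so normalisation to [k = 1] can wait until the end. *)
Definition mass_comb S k x := exists r c, [/\ uniq r, active c `<=` [set` r],
  active c `<=` S, forall y, 0 <= c y &
  x = \sum_(y <- r) c y *: y /\ k = \sum_(y <- r) c y].

Lemma mass_combP S k x : mass_comb S k x <->
  exists c, conic_comb S c x /\ \sum_(a \in active c) c a = k.
Proof.
split=> [[r [c [ur cr cS c0 [-> ->]]]]|[c [[/finite_seqP[r cr] cS c0 ->] <-]]].
  exists c; split; last by rewrite (sum_active ur cr).
  split=> //; first exact: sub_finite_set cr (finite_seq r).
  by rewrite (sum_active ur cr)// => y ->; rewrite scale0r.
have sr : active c `<=` [set` undup r] by rewrite cr => y /=; rewrite mem_undup.
exists (undup r), c; split=> //; first exact: undup_uniq.
by split; apply: sum_active; rewrite ?undup_uniq// => y ->; rewrite scale0r.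
Qed.

Lemma conv_hullP S x : conv_hull S x <-> mass_comb S 1 x.
Proof. by rewrite mass_combP. Qed.

Lemma mass_comb0 S : mass_comb S 0 0.
Proof.
exists [::], (fun=> 0); split=> //; rewrite ?big_nil// => y; rewrite /active/= ?eqxx//.
Qed.

Lemma mass_comb1 S k x : 0 <= k -> (k != 0 -> S x) -> mass_comb S k (k *: x).
Proof.
move=> k0 Sx; exists [:: x], (fun y => if y == x then k else 0); split=> //.
- by move=> y; rewrite /active/= mem_seq1; have [//|_] := eqVneq y x; rewrite eqxx.
- by move=> y; rewrite /active/=; have [->|_] := eqVneq y x; rewrite ?eqxx.
- by move=> y; case: ifP.
- by rewrite !big_seq1 eqxx.
Qed.

Lemma mass_combD S k l x y :
  mass_comb S k x -> mass_comb S l y -> mass_comb S (k + l) (x + y).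
Proof.
move=> [r [c [ur cr cS c0 [-> ->]]]] [s [d [us ds dS d0 [-> ->]]]].
(* The two lists may overlap, so both sums are extended to a duplicate-free union. *)
pose t := undup (r ++ s).
have ut : uniq t by exact: undup_uniq.
have widen (V : nmodType) (F : H -> V) q e : uniq q -> {subset q <= t} ->
    active e `<=` [set` q] -> (forall z, e z = 0 -> F z = 0) ->
    \sum_(z <- q) F z = \sum_(z <- t) F z.
  move=> uq qt eq F0; rewrite -(sum_active uq eq)// (sum_active ut)//.
  by move=> z /eq /= /qt.
have rt : {subset r <= t} by move=> z; rewrite mem_undup mem_cat => ->.
have st : {subset s <= t} by move=> z; rewrite mem_undup mem_cat orbC => ->.
have cd z : active (fun z => c z + d z) z -> active c z \/ active d z.
  rewrite /active/= => cdz; apply/orP; apply: contraNT cdz.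
  by rewrite negb_or !negbK => /andP[/eqP-> /eqP->]; rewrite addr0.
exists t, (fun z => c z + d z); split=> //.
- by move=> z /cd [/cr /= /rt|/ds /= /st].
- by move=> z /cd [/cS|/dS].
- by move=> z; rewrite addr_ge0.
have Z (e : H -> R) z : e z = 0 -> e z *: z = 0 by move=> ->; rewrite scale0r.
split.
  under [RHS]eq_bigr do rewrite scalerDl.
  rewrite big_split/= (widen _ _ r c)// ?(widen _ _ s d)//; exact: Z.
by rewrite big_split/= (widen _ _ r c)// (widen _ _ s d).
Qed.

Lemma mass_combZ S k l x : 0 <= l -> mass_comb S k x -> mass_comb S (l * k) (l *: x).
Proof.
move=> l0 [r [c [ur cr cS c0 [-> ->]]]].
have lc z : active (fun z => l * c z) z -> active c z.
  by rewrite /active/= mulf_eq0 negb_or => /andP[].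
exists r, (fun z => l * c z); split=> //.
- by move=> z /lc /cr.
- by move=> z /lc /cS.
- by move=> z; rewrite mulr_ge0.
by rewrite scaler_sumr mulr_sumr; split=> //; apply: eq_bigr => z _; rewrite scalerA.
Qed.

Lemma mass_comb_sum S (I : Type) (s : seq I) (k : I -> R) (x : I -> H) :
  (forall i, mass_comb S (k i) (x i)) ->
  mass_comb S (\sum_(i <- s) k i) (\sum_(i <- s) x i).
Proof.
move=> h; elim: s => [|i s ih]; first by rewrite !big_nil; exact: mass_comb0.
by rewrite !big_cons; exact: mass_combD.
Qed.

Lemma mass_comb_bind S T k x : T `<=` conv_hull S ->
  mass_comb T k x -> mass_comb S k x.
Proof.
move=> TS [r [c [ur cr cT c0 [-> ->]]]]; apply: mass_comb_sum => y.
have [->|cy] := eqVneq (c y) 0; first by rewrite scale0r; exact: mass_comb0.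
by rewrite -[X in mass_comb _ X]mulr1; apply: mass_combZ => //; exact/conv_hullP/TS/cT.
Qed.

Lemma conv_hull_idem S T : T `<=` conv_hull S -> conv_hull T `<=` conv_hull S.
Proof. by move=> TS x /conv_hullP/(mass_comb_bind TS)/conv_hullP. Qed.

Lemma sub_conv_hull S : S `<=` conv_hull S.
Proof.
by move=> x Sx; apply/conv_hullP; rewrite -[x]scale1r; exact: mass_comb1.
Qed.

Lemma convex_comb_hull S c x : convex_comb S c x -> conv_hull S x.
Proof. by exists c. Qed.

Lemma conv_hull_conv S x y k : 0 <= k <= 1 -> conv_hull S x -> conv_hull S y ->
  conv_hull S ((1 - k) *: x + k *: y).
Proof.
move=> /andP[k0 k1] /conv_hullP xS /conv_hullP yS; apply/conv_hullP.
rewrite -[X in mass_comb _ X](subrK k) -[X in mass_comb _ (X + _)]mulr1.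
rewrite -[X in mass_comb _ (_ + X)]mulr1; apply: mass_combD.
  by apply: mass_combZ => //; rewrite subr_ge0.
exact: mass_combZ.
Qed.

Lemma is_face_conv_hull S : is_face (conv_hull S) (conv_hull S).
Proof.
split=> // x y k; rewrite !inE => xS yS.
have := @conv_hull_conv S y x k%:num; rewrite !ge0/= le1 => /(_ isT yS xS).
by rewrite addrC.
Qed.

Lemma convex_comb_le1 S c x b : convex_comb S c x -> c b <= 1.
Proof.
move=> [[/finite_seqP[r cr] cS c0 _] <-].
have sr : active c `<=` [set` undup r] by rewrite cr => y /=; rewrite mem_undup.
rewrite (sum_active (undup_uniq r) sr)//.
have [bc|bc] := eqVneq (c b) 0; first by rewrite bc sumr_ge0.
by rewrite (bigD1_seq b) ?undup_uniq//=; [rewrite lerDl sumr_ge0|exact: sr].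
Qed.

Lemma mass_comb_remove S c x b : convex_comb S c x ->
  mass_comb S (1 - c b) (x - c b *: b).
Proof.
move=> [[/finite_seqP[r cr] cS c0 ->] <-].
have sr : active c `<=` [set` undup r] by rewrite cr => y /=; rewrite mem_undup.
rewrite (sum_active (undup_uniq r) sr)//.
rewrite (sum_active (undup_uniq r) sr) => [|y ->]; last by rewrite scale0r.
have [bc|bc] := eqVneq (c b) 0.
  rewrite bc scale0r !subr0; apply: mass_comb_sum => y.
  by apply: mass_comb1 => // cy; exact: cS.
rewrite (bigD1_seq b) ?undup_uniq//=; last exact: sr.
rewrite [X in _ (X - _)](bigD1_seq b) ?undup_uniq//=; last exact: sr.
rewrite !(addrC _ (\sum_(_ <- _ | _) _)) !addrK.
rewrite [X in mass_comb S X]big_mkcond [X in mass_comb S _ X]big_mkcond/=.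
apply: mass_comb_sum => y; case: ifP => _; last exact: mass_comb0.
by apply: mass_comb1 => // cy; exact: cS.
Qed.

Lemma mass_comb_eq0 S x : mass_comb S 0 x -> x = 0.
Proof.
move=> [r [c [ur cr cS c0 [-> /esym/eqP]]]].
rewrite psumr_eq0// => /allP h; rewrite big_seq big1// => y yr.
by have /= /eqP -> := h y yr; rewrite scale0r.
Qed.

(** An atom of weight below 1 writes [x] as a proper mixture of itself and a hull point formed by
    the other atoms, so extremality puts it in the face; an atom of weight 1 is [x] itself. *)
Lemma face_active S K c x : is_face (conv_hull S) K -> K x ->
  convex_comb S c x -> active c `<=` K.
Proof.
move=> [_ _ fK] Kx cx b; rewrite /active/= => cb.
have cb0 : 0 < c b by case: cx => -[_ _ c0 _] _; rewrite lt_neqAle eq_sym cb c0.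
have Sb : S b by case: cx => -[_ cS _ _] _; exact: cS.
have := mass_comb_remove b cx.
have [cb1|cb1] := eqVneq (c b) 1.
  by rewrite cb1 subrr scale1r => /mass_comb_eq0/eqP; rewrite subr_eq0 => /eqP<-.
have cb_lt1 : 0 < 1 - c b by rewrite subr_gt0 lt_neqAle cb1 (convex_comb_le1 b cx).
move=> /(mass_combZ (l := (1 - c b)^-1)); rewrite invr_ge0 (ltW cb_lt1).
rewrite mulVf ?gt_eqF// => /(_ isT)/conv_hullP h.
have t01 : 0 < c b < 1 by rewrite cb0 -subr_gt0.
have [] := fK _ b (c b) h (sub_conv_hull Sb) t01; last by [].
by rewrite scalerA mulfV ?gt_eqF// scale1r subrK.
Qed.

End MassComb.

(** * Positivity and upper bounds for the pyramidal width *)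

Section Width.
Context (R : realType) (H : completeNormedModType R)
  (dot : {dot H for @idfun R}) (dot_norm : induces_norm dot).
Implicit Types (A S T K : set H) (c : H -> R) (x y q r d : H).

Lemma convex_comb_dot_ge S c x d : convex_comb S c x ->
  exists2 b, active c b & dot d x <= dot d b.
Proof.
move=> cx; apply: contrapT => /forall2NP h.
have {}h b : c b != 0 -> dot d b < dot d x.
  by move=> cb; rewrite ltNge; apply/negP; case: (h b).
case: cx => -[/finite_seqP[r cr] cS c0 xE].
have sr : active c `<=` [set` undup r] by rewrite cr => y /=; rewrite mem_undup.
rewrite (sum_active (undup_uniq r) sr)// => c1.
move: xE; rewrite (sum_active (undup_uniq r) sr) => [xE|y ->]; last by rewrite scale0r.
have : \sum_(b <- undup r) c b * (dot d x - dot d b) = 0.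
  under eq_bigr do rewrite mulrBr.
  rewrite sumrB -mulr_suml c1 mul1r {1}xE raddf_sum/=.
  by apply/eqP; rewrite subr_eq0; apply/eqP/eq_bigr => b _; rewrite dotZr.
move=> /eqP; rewrite psumr_eq0 => [/allP all0|b _]; last first.
  have [->|cb] := eqVneq (c b) 0; first by rewrite mul0r.
  by rewrite mulr_ge0// subr_ge0 ltW// h.
have : \sum_(b <- undup r) c b = 0.
  rewrite big_seq big1// => b br; apply/eqP; apply: contraT => cb.
  have /= := all0 b br; rewrite mulf_eq0 (negPf cb)/= subr_eq0.
  by rewrite gt_eqF// h.
by rewrite c1 => /eqP; rewrite oner_eq0.
Qed.

Lemma convex_comb_dot_le S c x d : convex_comb S c x ->
  exists2 b, active c b & dot d b <= dot d x.
Proof.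
by move=> /(convex_comb_dot_ge (- d))[b cb]; rewrite !dotNl lerN2; exists b.
Qed.

Lemma conv_hull_dot_le A x d k : (forall a, A a -> dot d a <= k) ->
  conv_hull A x -> dot d x <= k.
Proof.
move=> dk [c cx]; have [b cb] := convex_comb_dot_ge d cx.
by move=> /le_trans; apply; apply: dk; case: cx => -[_ cS _ _] _; exact: cS.
Qed.

Context A (cA : compact A).

Lemma compact_normr_bound : exists2 M : R, 0 <= M & forall a, A a -> `|a| <= M.
Proof.
have [M [_ HM]] := compact_bounded cA.
exists (`|M| + 1) => [|a Aa]; first by rewrite addr_ge0.
by apply: (HM (`|M| + 1)) => //; rewrite (le_lt_trans (ler_norm M))// ltrDl.
Qed.

Lemma norm_le_diam x y : A x -> A y -> `|x - y| <= diam A.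
Proof.
move=> Ax Ay; have [M M0 HM] := compact_normr_bound.
apply: ub_le_sup; last by exists (x, y).
exists (M + M) => _ [[u v] [/= Au Av] <-].
by rewrite (le_trans (ler_normB _ _))// lerD// HM.
Qed.

(** Boundedness makes the suprema in [PdirW] genuine rather than default values. *)
Lemma dir_dot_le S r : S `<=` A ->
  has_ubound [set dot (`|r|^-1 *: r) (p.1 - p.2) | p in A `*` S].
Proof.
move=> SA; have [M M0 HM] := compact_normr_bound.
exists (M + M) => _ [[u v] [/= Au Sv] <-].
apply: le_trans (dot_le_norm dot_norm _ _) _; rewrite normrZ normfV normr_id.
have : `|u - v| <= M + M by rewrite (le_trans (ler_normB _ _))// lerD// HM//; exact: SA.
have [->|r0] := eqVneq r 0; first by rewrite normr0 mulr0 mul0r addr_ge0.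
by rewrite mulVf ?normr_eq0// mul1r.
Qed.

(** Since [dot r r] is positive, some generator [k - q] of the cone has positive product with [r];
    so has [b - q] for an atom [b] of [k], and [b] lies in the face. Every support of [q] has an
    atom no higher than [q], so each supremum is at least the same positive [kappa]. *)
Lemma PdirW_triple_pos K q r : pyramidal_triple A (K, q, r) ->
  exists s v, [/\ A s, A v, dot r v < dot r s & 0 < PdirW dot (K `&` A) r q].
Proof.
move=> [faceK Kq [c [cf cS c0 rE]] r0].
have rr0 : 0 < dot r r by rewrite -dot_norm exprn_gt0// normr_gt0.
have nr0 : 0 < `|r|^-1 by rewrite invr_gt0 normr_gt0.
have [k Kk rk] : exists2 k, K k & 0 < dot r (k - q).
  apply: contrapT => /forall2NP h; move: rr0; rewrite {2}rE.
  rewrite fsbig_finite// raddf_sum/= ltNge sumr_le0// => a _.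
  rewrite dotZr; have [->|ca] := eqVneq (c a) 0; first by rewrite mul0r.
  rewrite mulr_ge0_le0//; have [k Kk <-] := cS a ca.
  by rewrite leNgt; apply/negP; case: (h k).
have [c' k'] : conv_hull A k by case: faceK => _ sub _; exact: sub.
have [b c'b rb] := convex_comb_dot_ge r k'.
have Kb : K b by exact: face_active faceK Kk k' _ c'b.
have Ab : A b by case: k' => -[_ h _ _] _; exact: h.
have rbq : 0 < dot r (b - q) by move: rk; rewrite !dotBr; lra.
have [e qe] : conv_hull A q by case: faceK => _ sub _; exact: sub.
have eK := face_active faceK Kq qe.
have eA : active e `<=` A by case: qe => -[].
have [v ev rv] := convex_comb_dot_le r qe.
exists b, v; split=> //; first exact: eA.
  by move: rbq; rewrite dotBr; lra.
pose kappa := `|r|^-1 * dot r (b - q).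
have kappa0 : 0 < kappa by rewrite mulr_gt0.
apply: (lt_le_trans kappa0); apply: lb_le_inf.
  exists (sup [set dot (`|r|^-1 *: r) (p.1 - p.2) | p in (K `&` A) `*` active e]).
  exists (active e) => //; exists e => //.
  case: qe => -[e1 e2 e3 e4] e5; split=> //; split=> // y ey.
  by split; [exact: eK|exact: eA].
move=> _ [S [f qf ->] <-].
have fA : active f `<=` A by case: qf => -[_ h _ _] _ y /h[].
have [u fu ru] := convex_comb_dot_le r qf.
apply: (@le_trans _ _ (dot (`|r|^-1 *: r) (b - u))).
  by rewrite dotZl ler_pM2l// !dotBr; lra.
apply: ub_le_sup; last by exists (b, u).
have [M HM] := dir_dot_le r fA.
by exists M => _ [[p p'] [/= [_ Ap] fp'] <-]; apply: HM; exists (p, p').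
Qed.

Lemma PWidth_lbound : lbound [set PdirW_triple dot A p | p in pyramidal_triple A] 0.
Proof.
by move=> _ [[[K q] r] /PdirW_triple_pos[s [v [_ _ _ h]]] <-]; exact: ltW.
Qed.

Lemma PWidth_ge0 : 0 <= PWidth dot A.
Proof.
rewrite /PWidth; set E := (X in inf X).
(* Without admissible triples the infimum is the default value 0. *)
have [->|/set0P E0] := eqVneq E set0; first by rewrite inf0.
by apply: lb_le_inf => //; exact: PWidth_lbound.
Qed.

Lemma PWidth_le c x y kappa : convex_comb A c x -> conv_hull A y -> y != x ->
  (forall s v, A s -> active c v -> dot (y - x) (s - v) <= kappa * `|y - x|) ->
  PWidth dot A <= kappa.
Proof.
move=> cx yA yx h; have xA := convex_comb_hull cx.
have cA' : active c `<=` A by case: cx => -[].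
have nr0 : 0 < `|y - x| by rewrite normr_gt0 subr_eq0.
have tr : pyramidal_triple A (conv_hull A, x, y - x).
  split=> //; [exact: is_face_conv_hull| |by rewrite subr_eq0].
  have /mass_combP[e [? _]] : mass_comb [set k - x | k in conv_hull A] 1 (1 *: (y - x)).
    by apply: mass_comb1 => // _; exists y.
  by exists e; rewrite -[y - x]scale1r.
have [s [v [As _ _ _]]] := PdirW_triple_pos tr.
apply: (@le_trans _ _ (PdirW dot (conv_hull A `&` A) (y - x) x)).
  apply: ge_inf; first by exists 0; exact: PWidth_lbound.
  by exists (conv_hull A, x, y - x).
apply: (@le_trans _ _ (sup [set dot (`|y - x|^-1 *: (y - x)) (p.1 - p.2)
    | p in (conv_hull A `&` A) `*` active c])).
  apply: ge_inf; last first.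
    exists (active c) => //; exists c => //.
    case: cx => -[e1 e2 e3 e4] e5; split=> //; split=> // z cz.
    by split; [exact: sub_conv_hull (cA' _ cz)|exact: cA'].
  (* Any support of [x] has atoms at or above and at or below [x], so each supremum is at least 0
     and the infimum is genuine. *)
  exists 0 => _ [S [f xf ->] <-].
  have [u fu ru] := convex_comb_dot_le (y - x) xf.
  have [w fw rw] := convex_comb_dot_ge (y - x) xf.
  have fA : active f `<=` conv_hull A `&` A by case: xf => -[].
  apply: (@le_trans _ _ (dot (`|y - x|^-1 *: (y - x)) (w - u))).
    by rewrite dotZl mulr_ge0 ?invr_ge0// dotBr; lra.
  apply: ub_le_sup; last by exists (w, u) => //; split=> //; exact: fA.
  have [M HM] := @dir_dot_le (active f) (y - x) (fun z fz => (fA z fz).2).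
  by exists M => _ [[p p'] [/= [_ Ap] fp'] <-]; apply: HM; exists (p, p').
apply: ge_sup.
  have [u fu ru] := convex_comb_dot_le (y - x) cx.
  exists (dot (`|y - x|^-1 *: (y - x)) (s - u)); exists (s, u) => //.
  by split=> //; split=> //; exact: sub_conv_hull.
move=> _ [[p p'] [/= [_ Ap] fp'] <-].
by rewrite dotZl ler_pdivrMl// mulrC; exact: h.
Qed.

Lemma PWidth_le_diam a b : A a -> A b -> a != b -> PWidth dot A <= diam A.
Proof.
move=> Aa Ab ab.
have /conv_hullP/mass_combP[c cb] := sub_conv_hull Ab.
apply: (PWidth_le cb (sub_conv_hull Aa) ab) => s v As cv.
have Av : A v by case: cb => -[_ h _ _] _; exact: h.
apply: le_trans (dot_le_norm dot_norm _ _) _.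
by rewrite mulrC ler_wpM2r// norm_le_diam.
Qed.

End Width.

(** * Reduction to finitely many atoms *)

Section FiniteHull.
Context (R : realType) (H : completeNormedModType R)
  (dot : {dot H for @idfun R}) (dot_norm : induces_norm dot).
Implicit Types (S : set H) (c : H -> R) (x y : H) (r : seq H).

Lemma mass_comb_comb n (a : 'I_n -> H) S (w : 'rV[R]_n) :
  (forall i, 0 <= w 0 i) -> (forall i, w 0 i != 0 -> S (a i)) ->
  mass_comb S (\sum_i w 0 i) (comb a w).
Proof.
by move=> w0 wS; apply: mass_comb_sum => i; apply: mass_comb1 => // /wS.
Qed.

Lemma comb_conv_hull n (a : 'I_n -> H) S (w : 'rV[R]_n) : simplex w ->
  (forall i, w 0 i != 0 -> S (a i)) -> conv_hull S (comb a w).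
Proof. by move=> [w0 w1] /(mass_comb_comb w0); rewrite w1 => /conv_hullP. Qed.

Definition row_weights r c := \row_(i < size r) c (tnth (in_tuple r) i).

Lemma convex_comb_row r S c x : uniq r -> active c `<=` [set` r] ->
  convex_comb S c x ->
  simplex (row_weights r c) /\ comb (tnth (in_tuple r)) (row_weights r c) = x.
Proof.
move=> ur cr [[_ _ c0 ->] c1]; split.
  split=> [i|]; first by rewrite mxE.
  rewrite -c1 (sum_active ur cr)// [RHS]big_tnth.
  by apply: eq_bigr => i _; rewrite mxE.
rewrite (sum_active ur cr) => [|y ->]; last by rewrite scale0r.
by rewrite [RHS]big_tnth; apply: eq_bigr => i _; rewrite mxE.
Qed.

Context (A : set H) (cA : compact A).

(* If conv A left the hull of a finite eps-net V of A, then the nearest point p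
   of conv V to some y in conv A would give the direction y - p the pyramidal
   directional width at most eps. *)
Lemma conv_hull_finite : 0 < PWidth dot A ->
  exists2 r : seq H, [set` r] `<=` A & conv_hull A `<=` conv_hull [set` r].
Proof.
set W := PWidth dot A => W0; have W2 : 0 < W / 2 by rewrite divr_gt0.
have [r rA AD] : exists2 r : seq H, [set` r] `<=` A &
    A `<=` \bigcup_(x in [set` r]) ball x (W / 2).
  have /(_ H A (fun x => ball x (W / 2)))[||D DA AD] : cover_compact A.
  - by rewrite -compact_cover.
  - by move=> x _; exact: ball_open.
  - by move=> x Ax; exists x => //; exact: ballxx.
  by exists (finmap.enum_fset D) => // x /DA; rewrite inE.
exists r => // y yA.
pose a := tnth (in_tuple r).
have aA i : A (a i) by apply: rA; exact: mem_tnth.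
have [i0 _] : exists i : 'I_(size r), True.
  case: yA => c yc; have [b cb _] := convex_comb_dot_le dot 0 yc.
  have /AD[v vD _] : A b by case: yc => -[_ h _ _] _; exact: h.
  by have /tnthP[i _] : v \in in_tuple r by []; exists i.
pose F (w : 'rV[R]_(size r)) := `|y - comb a w|.
have cF : continuous F.
  move=> w; apply: (@cvg_norm _ _ _ (nbhs w)).
  exact: (@cvgB _ _ _ (nbhs w) _ _ _ _ _ (@cvg_cst _ _ _ (nbhs w) _)
    (@continuous_comb _ _ _ a w)).
have [||w] := @compact_EVT_min _ R F _ _ (@compact_simplex R (size r)).
- by exists (delta_mx 0 i0); exact: simplex_delta.
- exact: continuous_subspaceT.
rewrite inE => wS wmin; set p := comb a w.
(* Only atoms of nonzero weight are kept: by [supp] below, these all lie at the level of [p]. *)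
have pV : conv_hull [set a i | i in [set i | w 0 i != 0]] p.
  by apply: comb_conv_hull => // i wi; exists i.
have [yp|yp] := eqVneq y p.
  rewrite yp; apply: conv_hull_idem pV => _ [i _ <-].
  by apply: sub_conv_hull; exact: mem_tnth.
have out i : dot (y - p) (a i - p) <= 0.
  apply: (dot_le0_of_min dot_norm ltr01) => e /andP[e0 e1].
  have -> : y - p - e *: (a i - p) = y - comb a ((1 - e) *: w + e *: delta_mx 0 i).
    by rewrite comb_toward opprD addrA.
  apply: wmin; rewrite inE; apply: simplex_conv => //; first by rewrite (ltW e0).
  exact: simplex_delta.
have supp : forall j, w 0 j != 0 -> dot (y - p) (a j - p) = 0.
  by apply: (wmean0_supp wS) => [j _ //|]; rewrite dot_comb_mean// subrr dot0r.
have [c [[c1 cV c2 c3] c4]] := pV.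
have cp : convex_comb A c p.
  by split=> //; split=> // x /cV[i _ <-].
have : W <= W / 2; last by lra.
apply: (PWidth_le dot_norm cA cp yA yp) => s v As /cV[j /= wj <-].
(* Each [s] in [A] is within [W / 2] of a net point [a i], which by [out] is no higher than [p]. *)
have [x /[dup] xD /= xr xs] := AD s As.
have /tnthP[i xi] : x \in in_tuple r by exact: xr.
have := out i; rewrite -[tnth _ i]/(a i) in xi *.
have -> : dot (y - p) (s - a j) =
    dot (y - p) (s - a i) + dot (y - p) (a i - p) - dot (y - p) (a j - p).
  by rewrite !dotBr; ring.
rewrite (supp _ wj) subr0 => h.
apply: (@le_trans _ _ (dot (y - p) (s - a i))); first by rewrite gerDl.
apply: le_trans (dot_le_norm dot_norm _ _) _; rewrite mulrC ler_wpM2r//.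
by move: xs; rewrite -ball_normE /= xi distrC => /ltW.
Qed.

(** This carries [exchange] over to a compact [A]. The atoms of [c] are joined with finitely many
    generators of the hull if the width is positive. Otherwise they are joined with the atoms of one
    representation of [y], and the inequality is trivial. *)
Lemma exchange_hull c x y : convex_comb A c x -> conv_hull A y ->
  exists n (a : 'I_n -> H) (w b : 'rV[R]_n),
    [/\ simplex w /\ simplex b, comb a w = x /\ comb a b = y,
      forall i, w 0 i != 0 -> active c (a i), forall i, A (a i) &
      (\sum_i `|b 0 i - w 0 i|) / 2 * PWidth dot A <= `|y - x|].
Proof.
move=> cx yA; have cA' : active c `<=` A by case: cx => -[].
have [s [sA sy sW]] : exists s : seq H, [/\ [set` s] `<=` A, conv_hull [set` s] y
    & 0 < PWidth dot A -> conv_hull A `<=` conv_hull [set` s]].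
  have [W0|W0] := ltP 0 (PWidth dot A).
    by have [s sA As] := conv_hull_finite W0; exists s; split=> //; exact: As.
  case: (yA) => d [[/finite_seqP[s ds] dA d0 yE] d1]; exists s.
  split=> [z|//|//]; first by rewrite -ds; exact: dA.
  by exists d; split=> //; split=> //; [apply/finite_seqP; exists s|rewrite ds].
have [t ct] : exists t : seq H, active c = [set` t].
  by case: cx => -[/finite_seqP].
pose r := undup (t ++ s); pose a := tnth (in_tuple r).
have ur : uniq r by exact: undup_uniq.
have rA z : z \in r -> A z.
  rewrite mem_undup mem_cat => /orP[zt|zs]; last exact: sA.
  by apply: cA'; rewrite ct.
have aA i : A (a i) by apply: rA; exact: mem_tnth.
have cr : active c `<=` [set` r] by rewrite ct => z /= zt; rewrite mem_undup mem_cat zt.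
have sr : [set` s] `<=` [set` r] by move=> z /= zs; rewrite mem_undup mem_cat zs orbT.
have [wS wx] := convex_comb_row ur cr cx.
have [d yd] : conv_hull [set` r] y.
  by apply: conv_hull_idem sy => z zs; apply: sub_conv_hull; exact: sr.
have dr : active d `<=` [set` r] by case: yd => -[].
have [vS vy] := convex_comb_row ur dr yd.
have wc i : row_weights r c 0 i != 0 -> active c (a i) by rewrite mxE.
suff [b [bS bv bW]] : exists b, [/\ simplex b, comb a b = y &
    (\sum_i `|b 0 i - row_weights r c 0 i|) / 2 * PWidth dot A <= `|y - x|].
  by exists (size r), a, (row_weights r c), b.
have [W0|W0] := ltP 0 (PWidth dot A); last first.
  exists (row_weights r d); split=> //; apply: le_trans (normr_ge0 _).
  by rewrite mulr_ge0_le0// divr_ge0// sumr_ge0.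
rewrite -wx -vy; apply: (exchange dot_norm) => // e e' kappa eS e'S ee' h.
have [f [[f1 fV f2 f3] f4]] : conv_hull [set a i | i in [set i | e 0 i != 0]] (comb a e).
  by apply: comb_conv_hull => // i ei; exists i.
have fe : convex_comb A f (comb a e).
  by split=> //; split=> // z /fV[i _ <-].
have e'A : conv_hull A (comb a e') by exact: comb_conv_hull.
apply: (PWidth_le dot_norm cA fe e'A ee') => z v Az /fV[j /= ej <-].
(* The bound on the listed atoms extends to all [z] in [A]: it is linear in [z], and the hull of the
   list contains [A]. *)
rewrite dotBr lerBlDr; apply: (conv_hull_dot_le (A := [set` r])) => [u /= ur'|].
  have /tnthP[i ->] : u \in in_tuple r by [].
  by rewrite -lerBlDr -dotBr; exact: h.
apply: conv_hull_idem (sW W0 z (sub_conv_hull Az)) => u us.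
by apply: sub_conv_hull; exact: sr.
Qed.

End FiniteHull.

(** * The corrective step *)

Section Step.
Context (R : realType) (H : completeNormedModType R)
  (dot : {dot H for @idfun R}) (dot_norm : induces_norm dot).
Context (A : set H) (cA : compact A).
Context (f : H -> R) (g : H -> H) (L mu : R) (L0 : 0 < L) (mu0 : 0 < mu)
  (fL : smooth_on dot (conv_hull A) f g L)
  (fmu : strongly_convex_on dot (conv_hull A) f g mu).

Let W := PWidth dot A.
Let D := diam A.
Let kappa := (mu * W ^+ 2) / (L * D ^+ 2).

Lemma modulus_le a b : A a -> A b -> a != b -> mu <= L.
Proof.
move=> /sub_conv_hull Aa /sub_conv_hull Ab ab.
have := le_trans (fmu Aa Ab) (fL Aa Ab); rewrite lerD2l.
rewrite ler_pM2r; first by rewrite ler_pM2r.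
by rewrite exprn_gt0// normr_gt0 subr_eq0 eq_sym.
Qed.

Lemma diam_neq0 : D != 0 -> exists a b, [/\ A a, A b & a != b].
Proof.
apply: contra_neqP => h; apply/eqP; rewrite /D /diam.
set E := (X in sup X); have [->|/set0P[_ [[a b] [/= Aa Ab] _]]] := eqVneq E set0.
  by rewrite sup0.
suff -> : E = [set 0] by rewrite sup1.
have eqA u v : A u -> A v -> u = v.
  by move=> Au Av; apply/eqP; apply: contra_notT h => uv; exists u, v.
apply/seteqP; split=> [_ [[u v] [/= Au Av] <-]|_ ->].
  by rewrite (eqA u v)// subrr normr0.
by exists (a, a); rewrite /= ?subrr ?normr0.
Qed.

Lemma kappa01 : 0 <= kappa <= 1.
Proof.
have -> : 0 <= kappa by rewrite divr_ge0// mulr_ge0 ?sqr_ge0// ltW.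
rewrite andTb.
have [D0|/[dup] D0 /diam_neq0[a [b [Aa Ab ab]]]] := eqVneq D 0.
  by rewrite /kappa D0 expr0n/= mulr0 invr0 mulr0.
have WD : W <= D by exact: PWidth_le_diam ab.
have W0 : 0 <= W by exact: PWidth_ge0.
rewrite /kappa ler_pdivrMr ?mul1r; last by rewrite mulr_gt0// exprn_even_gt0.
apply: ler_pM => //; [exact: ltW|exact: sqr_ge0|exact: modulus_le ab|].
by rewrite ler_pXn2r// nnegrE (le_trans W0).
Qed.

(** An equality when [D] is nonzero; when [D] is 0, division by zero makes [kappa] equal to 0 and
    the left side vanishes. *)
Lemma kappa_mul : L * D ^+ 2 * kappa <= mu * W ^+ 2.
Proof.
have [D0|D0] := eqVneq D 0.
  by rewrite D0 expr0n/= mulr0 mul0r mulr_ge0 ?sqr_ge0// ltW.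
by rewrite mulrC divfK// mulf_neq0 ?expf_neq0// gt_eqF.
Qed.

(** Completing the square: up to the factor [2 / L] and an additive constant, the squared distance
    to the gradient step is the quadratic upper model at [q], so the projection minimises that model
    over the hull of [T]. *)
Lemma projection_descent (T : set H) q q' y : T `<=` conv_hull A ->
  conv_hull A q ->
  argmin_on (conv_hull T) (fun y => `|y - (q - L^-1 *: g q)| ^+ 2) q' ->
  conv_hull T y ->
  f q' <= f q + dot (g q) (y - q) + L / 2 * `|y - q| ^+ 2.
Proof.
move=> TA qA [q'T q'min] yT.
have q'A : conv_hull A q' by exact: conv_hull_idem q'T.
apply: le_trans (fL qA q'A) _.
have E u : `|u - (q - L^-1 *: g q)| ^+ 2 =
    2 / L * (dot (g q) (u - q) + L / 2 * `|u - q| ^+ 2) + `|L^-1 *: g q| ^+ 2.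
  rewrite opprB addrA addrAC (sqr_normD dot_norm) dotZr (dotC _ (g q)).
  by field; rewrite gt_eqF.
have := q'min _ yT; rewrite !E lerD2r ler_pM2l ?divr_gt0//.
by rewrite -!addrA lerD2l.
Qed.

(** Stated for a set [T] holding the active atoms and the oracle answer, since these span the
    comparison point [q + theta *: u]. *)
Lemma corrective_step_decrease (T : set H) (delta : R) q q' z qs c :
  0 < delta <= 1 -> T `<=` conv_hull A -> T z -> active c `<=` T ->
  convex_comb A c q -> approx_LMO dot A delta (g q) q z ->
  argmin_on (conv_hull T) (fun y => `|y - (q - L^-1 *: g q)| ^+ 2) q' ->
  conv_hull A qs ->
  f q' - f qs <= (1 - delta ^+ 2 * kappa) * (f q - f qs).
Proof.
move=> /andP[d0 d1] TA Tz cT cq [Az zq] q'min qsA.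
have qA := convex_comb_hull cq.
have descent y := projection_descent TA qA q'min (y := y).
have [n [a [w [b [[wS bS] [wq bqs] wc aA WE]]]]] := exchange_hull dot_norm cA cq qsA.
set G := g q in zq descent *.
set I := inf _ in zq.
(* [dot G] is bounded below on the bounded set [A], so [I] is a genuine infimum. *)
have I_le s : A s -> I <= dot G (s - q).
  move=> As; apply: ge_inf; last by exists s.
  have [M M0 HM] := compact_normr_bound cA.
  exists (- (`|G| * (M + `|q|))) => _ [u Au <-]; rewrite lerNl -dotNr.
  apply: le_trans (dot_le_norm dot_norm _ _) _; rewrite normrN ler_wpM2l//.
  by apply: le_trans (ler_normB _ _) _; rewrite lerD2r HM.
pose h i := dot G (a i - q).
have hI i : I <= h i by exact: I_le.
have wh : \sum_i w 0 i * h i = 0.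
  by rewrite dot_comb_mean// wq subrr dot0r.
have bh : \sum_i b 0 i * h i = dot G (qs - q).
  by rewrite dot_comb_mean// bqs.
pose tau := (\sum_i `|b 0 i - w 0 i|) / 2.
pose P i := excess w b i; pose N i := excess b w i.
have P0 i : 0 <= P i := excess_ge0 w b i.
have N0 i : 0 <= N i := excess_ge0 b w i.
have Pw i : P i <= w 0 i := excess_le i wS bS.
have NBP i : N i - P i = b 0 i - w 0 i := excessB b w i.
have sN : \sum_i N i = tau := sum_excess bS wS.
have sP : \sum_i P i = tau.
  by rewrite (sum_excess wS bS); under eq_bigr do rewrite distrC.
have tau0 : 0 <= tau by rewrite -sN sumr_ge0.
have tau1 : tau <= 1 by rewrite -sP -wS.2 ler_sum.
pose B := \sum_i P i * h i.
(* The added mass [tau] sits at levels at least [I], and the removed mass contributes [B]. *)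
have gap : tau * I - B <= dot G (qs - q).
  have -> : dot G (qs - q) = \sum_i N i * h i - B.
    rewrite -bh -[LHS]subr0 -[X in _ - X = _]wh -!sumrB.
    by apply: eq_bigr => i _; rewrite -!mulrBl NBP.
  by rewrite lerD2r -sN mulr_suml ler_sum// => i _; rewrite ler_wpM2l.
(* Moving the weights P from their atoms to z is good when 0 <= B; otherwise
   the Frank-Wolfe direction, which moves all weights proportionally, is. *)
have [m [m0 mw sm mB]] : exists m : 'I_n -> R, [/\ forall i, 0 <= m i,
    forall i, m i <= w 0 i, \sum_i m i = tau &
    delta * B <= \sum_i m i * h i].
  have [B0|B0] := leP 0 B.
    exists P; split=> //; rewrite -/B -[X in _ <= X]mul1r.
    by rewrite ler_wpM2r.
  exists (fun i => tau * w 0 i); split=> [i|i||].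
  - by rewrite mulr_ge0// wS.1.
  - by rewrite ler_piMl// wS.1.
  - by rewrite -mulr_sumr wS.2 mulr1.
  under eq_bigr do rewrite -mulrA.
  by rewrite -mulr_sumr wh mulr0 mulr_ge0_le0// ltW.
have [k0 k1] := andP kappa01.
(* Chosen so that the quadratic term of the model is absorbed by the strong convexity term in
   [e4]. *)
pose theta := delta * kappa.
have th0 : 0 <= theta by rewrite mulr_ge0// ltW.
have th1 : theta <= 1 by rewrite mulr_ile1// ltW.
pose u := \sum_i m i *: (z - a i).
have uE : u = tau *: z - \sum_i m i *: a i.
  rewrite /u; under eq_bigr do rewrite scalerBr.
  by rewrite sumrB -scaler_suml sm.
have nu : `|u| <= tau * D.
  apply: le_trans (ler_norm_sum _ _ _) _; rewrite -sm mulr_suml.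
  apply: ler_sum => i _; rewrite normrZ ger0_norm// ler_wpM2l//.
  exact: norm_le_diam.
(* The oracle bounds the slope of the mass arriving at [z] by [tau * (delta * I)], and the choice of
   [m] makes the removed levels sum to at least [delta * B]; [gap] then applies. *)
have du : dot G u <= delta * dot G (qs - q).
  have -> : dot G u = tau * dot G (z - q) - \sum_i m i * h i.
    rewrite /u dot_sumr -sm mulr_suml -sumrB; apply: eq_bigr => i _.
    by rewrite dotZr /h !dotBr; ring.
  have h1 : tau * dot G (z - q) <= tau * (delta * I) by rewrite ler_wpM2l.
  have h2 : delta * (tau * I - B) <= delta * dot G (qs - q).
    by rewrite ler_wpM2l// ltW.
  have h3 : delta * (tau * I - B) = tau * (delta * I) - delta * B by ring.
  lra.
(* As [theta * m i <= w 0 i], the remaining weights are nonnegative, and they are nonzero only at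
   active atoms, which lie in [T]. *)
have yT : conv_hull T (q + theta *: u).
  apply/conv_hullP.
  have -> : q + theta *: u =
      \sum_i (w 0 i - theta * m i) *: a i + (theta * tau) *: z.
    under eq_bigr do rewrite scalerBl -scalerA.
    by rewrite sumrB -scaler_sumr uE scalerBr scalerA -wq addrCA addrC addrAC.
  have -> : 1 = \sum_i (w 0 i - theta * m i) + theta * tau.
    by rewrite sumrB wS.2 -mulr_sumr sm subrK.
  have tm i : theta * m i <= w 0 i.
    by apply: le_trans (mw i); rewrite ler_piMl.
  apply: mass_combD; last by apply: mass_comb1 => //; exact: mulr_ge0.
  apply: mass_comb_sum => i; apply: mass_comb1; first by rewrite subr_ge0.
  move=> wi; apply/cT/wc; apply: contraNneq wi => w0.
  by have := tm i; have := mulr_ge0 th0 (m0 i); rewrite w0 => ? ?; apply/eqP; lra.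
have qu : q + theta *: u - q = theta *: u by rewrite addrC addKr.
have := descent _ yT; rewrite qu => des.
have strong := fmu qA qsA.
have sW : (tau * W) ^+ 2 <= `|qs - q| ^+ 2.
  by rewrite ler_pXn2r ?nnegrE// mulr_ge0// PWidth_ge0.
have su : `|u| ^+ 2 <= (tau * D) ^+ 2.
  by rewrite ler_pXn2r ?nnegrE// (le_trans (normr_ge0 u)).
have kL := kappa_mul.
move: des; rewrite dotZr normrZ (ger0_norm th0) exprMn => des.
have e1 : theta * dot G u <= theta * (delta * dot G (qs - q)) by rewrite ler_wpM2l.
have e2 : mu / 2 * (tau * W) ^+ 2 <= mu / 2 * `|qs - q| ^+ 2.
  by rewrite ler_wpM2l// divr_ge0// ltW.
have e3 : L / 2 * (theta ^+ 2 * `|u| ^+ 2) <= L / 2 * (theta ^+ 2 * (tau * D) ^+ 2).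
  have L2 : 0 <= L / 2 by rewrite divr_ge0// ltW.
  by rewrite (ler_wpM2l L2)// (ler_wpM2l (sqr_ge0 _)).
have e4 : L / 2 * (theta ^+ 2 * (tau * D) ^+ 2)
    <= theta * delta * (mu / 2 * (tau * W) ^+ 2).
  have -> : L / 2 * (theta ^+ 2 * (tau * D) ^+ 2) =
      theta * delta * tau ^+ 2 / 2 * (L * D ^+ 2 * kappa) by rewrite /theta; field.
  have -> : theta * delta * (mu / 2 * (tau * W) ^+ 2) =
      theta * delta * tau ^+ 2 / 2 * (mu * W ^+ 2) by field.
  by rewrite ler_wpM2l// divr_ge0// mulr_ge0 ?sqr_ge0// mulr_ge0// ltW.
have e5 : theta * delta * (dot G (qs - q) + mu / 2 * (tau * W) ^+ 2)
    <= theta * delta * (f qs - f q).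
  have td : 0 <= theta * delta by rewrite mulr_ge0// ltW.
  by apply: (ler_wpM2l td); rewrite -/G in strong; lra.
have tE : delta ^+ 2 * kappa = theta * delta by rewrite /theta; ring.
rewrite tE; move: e5; rewrite mulrDr mulrBr; lra.
Qed.

End Step.

(** * Application to runs of Variant 0 *)

Lemma corrective_set_sub (R : realType) (H : completeNormedModType R)
  (dot : {dot H for @idfun R}) (A : set H) (g : H -> H) (L delta : R)
  (q z : nat -> H) t : NCFW_run dot A g L delta q z ->
  corrective_set (q 0%N) z t `<=` conv_hull A.
Proof.
move=> [q0A run] x [->//|[i _ <-]].
by apply: sub_conv_hull; have [[]] := run i.
Qed.

Unset Implicit Arguments.

Theorem mainTheorem5
    (R : realType) (H : completeNormedModType R) (dot : {dot H for @idfun R})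
    (dot_norm : induces_norm dot)
    (A : set H) (cA : compact A)
    (f : H -> R) (g : H -> H) (L mu : R) (L0 : 0 < L) (mu0 : 0 < mu)
    (fg : gradient_on dot (conv_hull A) f g)
    (fL : smooth_on dot (conv_hull A) f g L)
    (fmu : strongly_convex_on dot (conv_hull A) f g mu)
    (qstar : H) (qstarP : argmin_on (conv_hull A) f qstar)
    (delta : R) (delta01 : 0 < delta <= 1)
    (q z : nat -> H) (run : NCFW_run dot A g L delta q z)
    (c : nat -> H -> R) (cP : NCFW_weights q z c) :
  let eps (t : nat) : R := f (q t) - f qstar in
  let beta : R :=
    delta ^+ 2 * ((mu * PWidth dot A ^+ 2) / (L * diam A ^+ 2)) in
  [/\ forall (t : nat) (v : H),
        active (c t) `<=` A ->
        away_vertex dot (g (q t)) (c t) v ->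
        good_step v (c t) (c t.+1) ->
        eps t.+1 <= (1 - beta) * eps t,
      beta <= 1
    & PWidth_attained dot A -> 0 < beta].
Proof.
move=> eps beta; have [d0 d1] := andP delta01.
have [k0 k1] := andP (kappa01 dot_norm cA L0 mu0 fL fmu).
split=> [t v ctA _ _||].
- have [lmo qmin] := run.2 t.
  have [[cf cS c0 qE] c1] := cP t.
  (* The corrective set may hold a starting point outside [A]; [ctA] turns the weights into a
     combination of atoms, as the pyramidal width requires. *)
  have cq : convex_comb A (c t) (q t) by split.
  have subT : corrective_set (q 0%N) z t `<=` corrective_set (q 0%N) z t.+1.
    by move=> x [->|[i it <-]]; [left|right; exists i => //; exact: ltnW].
  apply: (corrective_step_decrease dot_norm cA L0 mu0 fL fmu delta01
    (corrective_set_sub run) _ _ cq lmo qmin qstarP.1).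
  + by right; exists t => //=.
  + by move=> x /cS/subT.
- by rewrite /beta mulr_ile1 ?expr_le1 ?exprn_ge0// ltW.
move=> [[[K p] r] tr Wtr].
(* An attained width is the value at an admissible triple, hence positive; the same triple supplies
   two distinct points of [A], so the diameter is positive too. *)
have [s [v [As Av vs Wpos]]] := PdirW_triple_pos dot_norm cA tr.
have W0 : 0 < PWidth dot A by rewrite -Wtr.
have D0 : 0 < diam A.
  apply: lt_le_trans (norm_le_diam cA As Av); rewrite normr_gt0 subr_eq0.
  by apply: contraTneq vs => ->; rewrite ltxx.
by rewrite mulr_gt0 ?exprn_gt0// divr_gt0// mulr_gt0// exprn_gt0.
Qed.
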